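(* Let $n\ge 0$ be an integer and let $a,b,c,d,z$ be complex numbers with $azq^{n+1}=bcd$. Then $$ {}_{8}W_{7}\left[z;b,c,d,\tfrac za,q^{-n};q,q\right]=\frac{(zq,\;zq/(bc),\;zq/(bd),\;zq/(cd);q)_n}{(zq/b,\;zq/c,\;zq/d,\;zq/(bcd);q)_n}. $$
   Context: Fix a complex number $q$ with $0<|q|<1$. Set $(x;q)_\infty=\prod_{n\ge 0}(1-xq^n)$, $(x;q)_n=(x;q)_\infty/(xq^n;q)_\infty$ (so $(x;q)_n=\prod_{k=0}^{n-1}(1-xq^k)$ for $n\ge0$), and $(x_1,\dots,x_m;q)_n=\prod_i (x_i;q)_n$. Very-well-poised unilateral series: ${}_8W_7[a_1;a_4,\dots,a_8;q,Z]=\sum_{k=0}^{\infty}\frac{1-a_1q^{2k}}{1-a_1}\frac{(a_1;q)_k}{(q;q)_k}\prod_{i=4}^{8}\frac{(a_i;q)_k}{(a_1q/a_i;q)_k}\,Z^k$ (here it terminates because of the parameter $q^{-n}$). Convention: all parameters are nonzero and such that no denominator appearing vanishes. *)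

(* Defs.v *)
From mathcomp Require Import all_boot all_order all_algebra.
From mathcomp Require Import all_classical all_reals all_analysis.
From mathcomp Require Export complex.

Set Implicit Arguments.
Unset Strict Implicit.
Unset Printing Implicit Defensive.

Import Order.TTheory GRing.Theory Num.Theory.
Import numFieldNormedType.Exports.

Local Open Scope ring_scope.

(* (x; q)_n for n >= 0.  The finite product is used rather than the quotient
   (x; q)_oo / (x q^n; q)_oo, which is 0/0 when x = q^-m with m >= n (as happens
   for the parameter q^-n of a terminating series). *)
Definition qpoch (K : fieldType) (x q : K) (n : nat) : K :=
  \prod_(0 <= k < n) (1 - x * q ^+ k).

(* (x_1, ..., x_m; q)_n *)
Definition qpochs (K : fieldType) (xs : seq K) (q : K) (n : nat) : K :=
  \prod_(x <- xs) qpoch x q n.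

Definition W87_term (K : fieldType) (a1 : K) (s : 5.-tuple K) (q Z : K)
    (k : nat) : K :=
  (1 - a1 * q ^+ (2 * k)) / (1 - a1) * (qpoch a1 q k / qpoch q q k)
  * (\prod_(x <- s) (qpoch x q k / qpoch (a1 * q / x) q k)) * Z ^+ k.

Definition W87_convergent (K : numFieldType) (a1 : K) (s : 5.-tuple K)
    (q Z : K) : Prop :=
  cvgn (series (W87_term a1 s q Z)).

(* 8W7[a1; a4, ..., a8; q, Z] with s = (a4, ..., a8).  The topology on K is the
   one given by its norm; limn is a junk value unless W87_convergent holds. *)
Definition W87 (K : numFieldType) (a1 : K) (s : 5.-tuple K) (q Z : K) : K :=
  limn (series (W87_term a1 s q Z)).

(* Main.v *)
(* Jackson's summation by the WZ method.  Write w = bcd/z; the balancing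
   condition reads a q^(n+1) = w, so for fixed z, b, c, d both sides are
   functions of n, and the quotient of the right-hand sides at n+1 and n is a
   product N/P.  If F(n,k) is the k-th summand, then P F(n+1,k) - N F(n,k) is a
   difference in k of an explicit hypergeometric term, whence the theorem by
   induction on n.  This fails to pass from n to n+1 only when z q^(n+1) = 1,
   since F(n,k) may then have a zero denominator; in that case the right-hand
   side at n+1 is 0, and so is the sum, because F(n+1,n+1-k) = -F(n+1,k). *)
Require Import Defs.
From mathcomp Require Import all_boot all_order all_algebra.
From mathcomp Require Import all_classical all_reals all_analysis.
From mathcomp Require Import ring zify.
Import Order.TTheory GRing.Theory Num.Theory.
Import numFieldNormedType.Exports.
Local Open Scope classical_set_scope.
Local Open Scope ring_scope.

Set Implicit Arguments.
Unset Strict Implicit.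

(** * Finite q-shifted factorials *)

Section Qpoch.
Variables (K : fieldType) (q : K).

Lemma qpoch0 (x : K) : qpoch x q 0 = 1.
Proof. by rewrite /qpoch big_geq. Qed.

Lemma qpochS (x : K) n : qpoch x q n.+1 = qpoch x q n * (1 - x * q ^+ n).
Proof. by rewrite /qpoch big_nat_recr. Qed.

Lemma qpochSl (x : K) n : qpoch x q n.+1 = (1 - x) * qpoch (x * q) q n.
Proof.
rewrite /qpoch big_nat_recl // expr0 mulr1; congr (_ * _).
by apply: eq_bigr => i _; rewrite exprS mulrA.
Qed.

Lemma qpoch_neq0 (x : K) n :
  (forall i, (i < n)%N -> x * q ^+ i != 1) -> qpoch x q n != 0.
Proof.
move=> h; rewrite /qpoch prodf_seq_neq0; apply/allP => i.
by rewrite mem_index_iota /= => /h; rewrite subr_eq0 eq_sym.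
Qed.

Lemma qpoch_neq0P (x : K) n i : qpoch x q n != 0 -> (i < n)%N -> x * q ^+ i != 1.
Proof.
rewrite /qpoch prodf_seq_neq0 => /allP /(_ i) + lin.
by rewrite mem_index_iota /= lin subr_eq0 eq_sym => /(_ isT).
Qed.

Lemma qpoch_sub_neq0 (x : K) n k :
  qpoch x q n != 0 -> (k <= n)%N -> qpoch x q k != 0.
Proof.
move=> h kn; apply: qpoch_neq0 => i ik.
by apply: qpoch_neq0P h _; apply: leq_trans kn.
Qed.

Lemma qpoch_expN_eq0 n k : q != 0 -> (n < k)%N -> qpoch (q ^- n) q k = 0.
Proof.
move=> q0 nk; apply/eqP; apply: contraT => /qpoch_neq0P /(_ nk).
by rewrite mulVf ?eqxx // expf_neq0.
Qed.

End Qpoch.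

(** * The summand, its certificate and the rational functions relating them *)

Section Jackson.
Variables (K : numFieldType) (q b c d z : K).
Hypotheses (q0 : q != 0) (hq : forall i, (0 < i)%N -> q ^+ i != 1).
Hypotheses (b0 : b != 0) (c0 : c != 0) (d0 : d != 0) (z0 : z != 0).
Hypothesis (z1 : 1 - z != 0).

Let w := b * c * d / z.
Let w0 : w != 0. Proof. by rewrite !mulf_neq0 ?invr_neq0. Qed.

Let qp x k := qpoch x q k.

(** The parameter a is eliminated through a = w / q^(n+1): then z/a = z q^(n+1) / w, and its partner
    zq/(z/a) = aq is w / q^n. *)
Let term n k :=
  (1 - z * q ^+ (2 * k)) / (1 - z) * (qp z k / qp q k) *
  ((qp b k / qp (z * q / b) k) * (qp c k / qp (z * q / c) k) *
   (qp d k / qp (z * q / d) k) *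
   (qp (z * q ^+ n.+1 / w) k / qp (w / q ^+ n) k) *
   (qp (q ^- n) k / qp (z * q ^+ n.+1) k)) * q ^+ k.

(* Up to the constant [g (q ^+ n.+1)], the certificate of the telescoping sum. *)
Let cert n m :=
  qp z m.+1 * qp b m.+1 * qp c m.+1 * qp d m.+1 *
    qp (z * q ^+ n.+2 / w) m * qp (q ^- n) m /
  (qp q m * qp (z * q / b) m * qp (z * q / c) m * qp (z * q / d) m *
    qp (w / q ^+ n) m * qp (z * q ^+ n.+2) m * (1 - z)).

(* [N (q ^+ n.+1) / P (q ^+ n.+1)] is the quotient of the right-hand sides at
   [n.+1] and at [n]. *)
Let P Q := (1 - z * Q / b) * (1 - z * Q / c) * (1 - z * Q / d) * (1 - Q / w).
Let N Q := (1 - z * Q) * (1 - z * Q / (b * c)) * (1 - z * Q / (b * d)) *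
           (1 - z * Q / (c * d)).
Let D X := (1 - X) * (1 - z * X / b) * (1 - z * X / c) * (1 - z * X / d).
Let g Q := - (Q / w) * (1 - z * Q ^+ 2 / w).
(** With Q = q^(n+1) and X = q^(m+1), [r1], [r2], [r3] are the quotients of [term n.+1 m.+1],
    [term n m.+1] and [cert n m.+1] by [cert n m]. *)
Let r1 Q X := X * (1 - z * X ^+ 2) * (1 - z * Q * X / w) * (1 - Q^-1) /
        (D X * (1 - w / Q) * (1 - z * Q * X)).
Let r2 Q X := X * (1 - z * X ^+ 2) * (1 - z * Q / w) * (1 - X / Q) /
        (D X * (1 - w * X / Q) * (1 - z * Q)).
Let r3 Q X := (1 - z * X) * (1 - b * X) * (1 - c * X) * (1 - d * X) *
       (1 - z * Q * X / w) * (1 - X / Q) /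
       (D X * (1 - w * X / Q) * (1 - z * Q * X)).

(** * Reduction of the WZ equation to rational identities in Q and X *)

Lemma term_succ_succ n m :
  term n.+1 m.+1 = cert n m * r1 (q ^+ n.+1) (q ^+ m.+1).
Proof.
have e1 : q ^- n.+1 * q = q ^- n by rewrite exprS invfM mulrAC mulVf ?mul1r.
have e2 : w / q ^+ n.+1 * q = w / q ^+ n by rewrite -mulrA e1.
rewrite /term /cert /r1 /D /qp.
rewrite [in LHS](qpochS _ q) [in LHS](qpochS _ (z * q / b)).
rewrite [in LHS](qpochS _ (z * q / c)) [in LHS](qpochS _ (z * q / d)).
rewrite [in LHS](qpochS _ (z * q ^+ n.+2 / w)).
rewrite [in LHS](qpochS _ (z * q ^+ n.+2)).
(* For these two parameters the first factor is split off, not the last: the remaining product then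
   starts at the parameter belonging to n. *)
rewrite [in LHS](qpochSl _ (q ^- n.+1)) [in LHS](qpochSl _ (w / q ^+ n.+1)).
rewrite e1 e2.
have -> : z * q ^+ n.+2 / w * q ^+ m = z * q ^+ n.+1 * q ^+ m.+1 / w.
  by rewrite !exprS; ring.
have -> : z * q ^+ n.+2 * q ^+ m = z * q ^+ n.+1 * q ^+ m.+1.
  by rewrite !exprS; ring.
have ee x : z * q / x * q ^+ m = z * q ^+ m.+1 / x by rewrite !exprS; ring.
rewrite !ee -exprS mulnC exprM !invfM.
ring.
Qed.

Lemma term_succ n m : term n m.+1 = cert n m * r2 (q ^+ n.+1) (q ^+ m.+1).
Proof.
have e1 : q ^- n * q ^+ m = q ^+ m.+1 / q ^+ n.+1.
  by rewrite !exprS invfM mulrACA mulfV // mul1r mulrC.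
have e2 : w / q ^+ n * q ^+ m = w * q ^+ m.+1 / q ^+ n.+1.
  by rewrite -mulrA e1 mulrA.
rewrite /term /cert /r2 /D /qp.
rewrite [in LHS](qpochS _ q) [in LHS](qpochS _ (z * q / b)).
rewrite [in LHS](qpochS _ (z * q / c)) [in LHS](qpochS _ (z * q / d)).
rewrite [in LHS](qpochSl _ (z * q ^+ n.+1 / w)).
rewrite [in LHS](qpochSl _ (z * q ^+ n.+1)).
rewrite [in LHS](qpochS _ (q ^- n)) [in LHS](qpochS _ (w / q ^+ n)) e1 e2.
have -> : z * q ^+ n.+1 / w * q = z * q ^+ n.+2 / w by rewrite !exprS; ring.
have -> : z * q ^+ n.+1 * q = z * q ^+ n.+2 by rewrite !exprS; ring.
have ee x : z * q / x * q ^+ m = z * q ^+ m.+1 / x by rewrite !exprS; ring.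
rewrite !ee -exprS mulnC exprM !invfM.
ring.
Qed.

Lemma cert_succ n m : cert n m.+1 = cert n m * r3 (q ^+ n.+1) (q ^+ m.+1).
Proof.
have e1 : q ^- n * q ^+ m = q ^+ m.+1 / q ^+ n.+1.
  by rewrite !exprS invfM mulrACA mulfV // mul1r mulrC.
have e2 : w / q ^+ n * q ^+ m = w * q ^+ m.+1 / q ^+ n.+1.
  by rewrite -mulrA e1 mulrA.
rewrite /cert /r3 /D /qp !(qpochS _ _ m.+1) !(qpochS _ (_ / _) m).
rewrite !(qpochS _ (z * q ^+ n.+2) m) (qpochS _ q m) (qpochS _ (q ^- n) m).
rewrite e1 e2.
have -> : z * q ^+ n.+2 / w * q ^+ m = z * q ^+ n.+1 * q ^+ m.+1 / w.
  by rewrite !exprS; ring.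
have -> : z * q ^+ n.+2 * q ^+ m = z * q ^+ n.+1 * q ^+ m.+1.
  by rewrite !exprS; ring.
have ee x : z * q / x * q ^+ m = z * q ^+ m.+1 / x by rewrite !exprS; ring.
rewrite !ee -exprS !invfM.
ring.
Qed.

Lemma subr1_div_neq0 (x y : K) : y != 0 -> 1 - x / y != 0 -> y - x != 0.
Proof.
move=> y0; apply: contraNneq => /eqP; rewrite subr_eq0 => /eqP <-.
by rewrite mulfV // subrr.
Qed.

(** The WZ equation at k = 0, where both summands are 1; it fixes the constant [g]. *)
Lemma certificate0 Q : P Q - N Q = g Q * ((1 - b) * (1 - c) * (1 - d)).
Proof. by rewrite /P /N /g /w; field; rewrite b0 c0 d0 z0. Qed.

(** The WZ equation at k = m+1 after division by [cert n m]. *)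
Lemma certificate Q X : Q != 0 -> 1 - z * Q != 0 -> 1 - w / Q != 0 ->
  1 - w * X / Q != 0 -> 1 - z * Q * X != 0 -> D X != 0 ->
  P Q * r1 Q X - N Q * r2 Q X = g Q * (r3 Q X - 1).
Proof.
rewrite /D !mulf_eq0 !negb_or => Q0 h1 h2 h3 h4.
move=> /andP[/andP[/andP[h5 h6] h7] h8].
have hw x : 1 - b * c * d / z * x / Q != 0 -> z * Q - b * c * d * x != 0.
  move=> h; have -> : z * Q - b * c * d * x = z * (Q - b * c * d / z * x).
    by field.
  by rewrite mulf_neq0 // subr1_div_neq0.
have h2' : z * Q - b * c * d != 0.
  by have := hw 1; rewrite !mulr1; apply.
rewrite /P /N /g /r1 /r2 /r3 /D /w; field.
by rewrite Q0 z0 d0 c0 b0 h4 h5 h1 h2' (hw _ h3) (subr1_div_neq0 b0 h6)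
  (subr1_div_neq0 c0 h7) (subr1_div_neq0 d0 h8).
Qed.

(** At X = Q the factor 1 - X / Q removes [r2] and [r3] from the WZ equation. Specializing
    [certificate] would require w to differ from 1, which [nondegenerate] does not provide. *)
Lemma certificate_last Q : Q != 0 -> 1 - w / Q != 0 -> 1 - z * Q * Q != 0 ->
  D Q != 0 -> P Q * r1 Q Q = - g Q.
Proof.
rewrite /D !mulf_eq0 !negb_or => Q0 h2 h4 /andP[/andP[/andP[h5 h6] h7] h8].
have hw : z * Q - b * c * d != 0.
  have -> : z * Q - b * c * d = z * (Q - b * c * d / z) by field.
  by rewrite mulf_neq0 // subr1_div_neq0.
rewrite /P /g /r1 /D /w; field.
by rewrite Q0 z0 d0 c0 b0 h4 h5 hw (subr1_div_neq0 b0 h6)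
  (subr1_div_neq0 c0 h7) (subr1_div_neq0 d0 h8).
Qed.

(** * Telescoping in k, and the passage from n to n+1 *)

Lemma term_0 n : term n 0 = 1.
Proof. by rewrite /term /qp !qpoch0 expr0 !mulr1 !divff ?oner_eq0 ?mulr1. Qed.

(* The last condition excludes the zeros of [qpoch (z * q ^+ n.+1) q n] only, so
   [z * q ^+ i = 1] with [0 < i <= n] is allowed. *)
Definition nondegenerate n := [/\
  forall i, (0 < i <= n)%N -> z * q ^+ i != b,
  forall i, (0 < i <= n)%N -> z * q ^+ i != c,
  forall i, (0 < i <= n)%N -> z * q ^+ i != d,
  forall i, (0 < i <= n)%N -> b * c * d / z != q ^+ i &
  forall i, (n < i <= n.*2)%N -> z * q ^+ i != 1].

Lemma subr_div_neq0 (x y : K) : y != 0 -> x != y -> 1 - x / y != 0.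
Proof.
move=> y0; apply: contraNneq => /eqP; rewrite subr_eq0 => /eqP e.
by rewrite -[y]mul1r e divfK.
Qed.

Lemma D_neq0 n m : nondegenerate n -> (0 < m <= n)%N -> D (q ^+ m) != 0.
Proof.
move=> [hb hc hd _ _] mn.
rewrite /D !mulf_neq0 ?subr_div_neq0 ?hb ?hc ?hd //.
by rewrite subr_eq0 eq_sym hq //; case/andP: mn.
Qed.

Lemma term_telescope n m : nondegenerate n.+1 -> 1 - z * q ^+ n.+1 != 0 ->
  (m <= n)%N ->
  P (q ^+ n.+1) * (\sum_(0 <= k < m.+1) term n.+1 k) -
  N (q ^+ n.+1) * (\sum_(0 <= k < m.+1) term n k) = g (q ^+ n.+1) * cert n m.
Proof.
move=> nd h1; have [_ _ _ hw hz] := nd; elim: m => [|m IH] mn.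
  rewrite !big_nat1 !term_0 !mulr1 certificate0 /cert /qp.
  rewrite !qpoch0 !qpochS !qpoch0.
  rewrite !expr0 !mulr1 !mul1r; congr (_ * _).
  by field.
have Q0 : q ^+ n.+1 != 0 by rewrite expf_neq0.
rewrite big_nat_recr //= [in X in _ - X]big_nat_recr //=.
rewrite !mulrDr opprD addrACA IH; last exact: ltnW.
rewrite term_succ_succ term_succ cert_succ !(mulrCA _ (cert n m)) -mulrBr.
rewrite certificate //.
- by ring.
- by rewrite subr_div_neq0 // hw // ltnS leqnn.
- rewrite subr_div_neq0 //.
  (* A zero here would mean w = q^(n-m), which is excluded because m < n in the inductive step. *)
  have -> : q ^+ n.+1 = q ^+ (n - m) * q ^+ m.+1.
    by rewrite -exprD; congr (_ ^+ _); clear -mn; lia.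
  by rewrite (inj_eq (mulIf (expf_neq0 _ q0))) hw //; clear -mn; lia.
- by rewrite -mulrA -exprD subr_eq0 eq_sym hz //; clear -mn; lia.
- by apply: D_neq0 nd _; clear -mn; lia.
Qed.

Lemma term_last n : nondegenerate n.+1 ->
  P (q ^+ n.+1) * term n.+1 n.+1 = - g (q ^+ n.+1) * cert n n.
Proof.
move=> nd; have [_ _ _ hw hz] := nd.
have Q0 : q ^+ n.+1 != 0 by rewrite expf_neq0.
rewrite term_succ_succ mulrCA certificate_last //.
- by rewrite mulrC.
- by rewrite subr_div_neq0 // hw // ltnS leqnn.
- by rewrite -mulrA -exprD subr_eq0 eq_sym hz //; clear; lia.
- by apply: D_neq0 nd _; rewrite leqnn.
Qed.

(** The boundary value left by telescoping up to k = n cancels against the extra summand k = n+1. *)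
Lemma term_sum_succ n : nondegenerate n.+1 -> 1 - z * q ^+ n.+1 != 0 ->
  P (q ^+ n.+1) * (\sum_(0 <= k < n.+2) term n.+1 k) =
  N (q ^+ n.+1) * (\sum_(0 <= k < n.+1) term n k).
Proof.
move=> nd h1; rewrite big_nat_recr //= mulrDr term_last //.
by rewrite mulNr -(term_telescope nd h1 (leqnn _)) opprB addrC subrK.
Qed.

(** * The exceptional case z q^n = 1: antisymmetry under k -> n-k *)

Let kappa k := \prod_(0 <= i < k) (z * q ^+ i.+1).

(** [kappa k] is z^k q^(k(k+1)/2). Only its sixth power has to be evaluated, so squaring avoids the
    halved exponent. *)
Lemma kappa_sqr k : kappa k ^+ 2 = z ^+ (2 * k) * q ^+ (k * k.+1).
Proof.
rewrite /kappa; elim: k => [|k IH]; first by rewrite big_geq // expr1n mul1r.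
rewrite big_nat_recr //= exprMn IH exprMn -exprM mulrACA -!exprD.
by congr (_ ^+ _ * _ ^+ _); lia.
Qed.

Lemma kappa_neq0 k : kappa k != 0.
Proof.
by rewrite prodf_seq_neq0; apply/allP => i _; rewrite mulf_neq0 ?expf_neq0.
Qed.

(** Since 1/(z q^i) = q^(n-i), one has 1 - z q^i / x = -(z q^i / x)(1 - x q^(n-i)); for i = 1, ...,
    k these supply the top k factors missing from (x; q)_(n-k). *)
Lemma qpoch_reflect n x k : x != 0 -> z * q ^+ n = 1 -> (k <= n)%N ->
  qp (z * q / x) k * qp x (n - k) = qp x n * (kappa k / (- x) ^+ k).
Proof.
move=> x0 zq; rewrite /kappa /qp; elim: k => [|k IH] kn.
  by rewrite subn0 qpoch0 big_geq // expr0 divr1 mul1r mulr1.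
have e : (n - k = (n - k.+1).+1)%N by lia.
have e2 : z * q ^+ k.+1 * q ^+ (n - k.+1) = 1.
  by rewrite -mulrA -exprD subnKC.
have hz : z * q ^+ k.+1 != 0 by rewrite mulf_neq0 ?expf_neq0.
have := IH (ltnW kn); rewrite e qpochS => {}IH.
rewrite big_nat_recr //= [(- x) ^+ _]exprSr invfM [X in _ = _ * X]mulrACA.
rewrite [RHS]mulrA -IH qpochS.
have -> : q ^+ (n - k.+1) = (z * q ^+ k.+1)^-1.
  by apply: (mulfI hz); rewrite e2 mulfV.
have -> : z * q / x * q ^+ k = z * q ^+ k.+1 / x by rewrite exprS; ring.
have -> : 1 - z * q ^+ k.+1 / x =
  (1 - x / (z * q ^+ k.+1)) * (z * q ^+ k.+1 / - x).
  by field; rewrite x0 z0 expf_neq0.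
by ring.
Qed.

(** Separates a well-poised quotient into a part symmetric under k -> n-k and an explicit
    monomial. *)
Lemma qpoch_ratio_reflect n x k : x != 0 -> z * q ^+ n = 1 ->
  qp (z * q / x) n != 0 -> (k <= n)%N ->
  qp x k / qp (z * q / x) k =
  qp x k * qp x (n - k) / qp x n * ((- x) ^+ k / kappa k).
Proof.
move=> x0 zq hx kn.
have hn : qp x n != 0.
  apply: contraNneq hx => h; have := qpoch_reflect x0 zq (leqnn n).
  by rewrite h mul0r subnn [qp x 0]qpoch0 mulr1 => ->.
have hk : qp x (n - k) != 0 by apply: qpoch_sub_neq0 hn _; apply: leq_subr.
have hx' : qp (z * q / x) k != 0 by apply: qpoch_sub_neq0 hx _.
have -> : qp x n = qp (z * q / x) k * qp x (n - k) / (kappa k / (- x) ^+ k).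
  rewrite qpoch_reflect // mulfK //.
  by rewrite mulf_neq0 ?kappa_neq0 ?invr_neq0 ?expf_neq0 ?oppr_eq0.
field; rewrite hx' hk kappa_neq0 expf_neq0 ?oppr_eq0 //.
Qed.

Lemma term_antisym n k : nondegenerate n -> z * q ^+ n = 1 -> (k <= n)%N ->
  term n (n - k) = - term n k.
Proof.
move=> [hb hc hd hw hz] zq kn.
have hqe x i : x != 0 -> z * q ^+ i.+1 != x -> z * q / x * q ^+ i != 1.
  move=> x0; apply: contraNneq => e.
  by rewrite -[x]mulr1 -e exprS; apply/eqP; field.
have nb : qp (z * q / b) n != 0.
  by apply: qpoch_neq0 => i il; apply: hqe => //; apply: hb.
have nc : qp (z * q / c) n != 0.
  by apply: qpoch_neq0 => i il; apply: hqe => //; apply: hc.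
have ndd : qp (z * q / d) n != 0.
  by apply: qpoch_neq0 => i il; apply: hqe => //; apply: hd.
have nz : qp (z * q / z) n != 0.
  apply: qpoch_neq0 => i il; apply: hqe => //.
  by rewrite -subr_eq0 -[X in _ - X]mulr1 -mulrBr mulf_neq0 // subr_eq0 hq.
pose e := z * q ^+ n.+1 / w.
have e0 : e != 0 by rewrite !mulf_neq0 ?expf_neq0 ?invr_neq0.
have ne : qp (z * q / e) n != 0.
  apply: qpoch_neq0 => i il; apply: hqe => //.
  rewrite /e; apply: contraTneq (hw (n - i)%N _);
    last by clear -il; lia.
  move=> /(congr1 (fun t => t * w)); rewrite divfK //.
  have -> : n.+1 = ((n - i) + i.+1)%N by clear -il; lia.
  rewrite exprD -mulrA => /(mulfI z0).
  rewrite mulrC => /(mulIf (expf_neq0 _ q0)) we.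
  by rewrite negbK; apply/eqP.
have eqn : q ^- n = z.
  by apply: (mulIf (expf_neq0 n q0)); rewrite zq mulVf ?expf_neq0.
have eq1 : z * q / z = q by field.
have eqz : z * q ^+ n.+1 = q by rewrite exprSr mulrA zq mul1r.
have ee : z * q / e = w * z by rewrite /e eqz; field; rewrite q0 w0.
(* The symmetric part. The square arises because q^-n = z and z q^(n+1) = q make the last quotient
   of [term] equal to (z; q)_k / (q; q)_k. *)
pose S k := (qp z k * qp z (n - k) / qp z n) ^+ 2 *
  (qp b k * qp b (n - k) / qp b n) * (qp c k * qp c (n - k) / qp c n) *
  (qp d k * qp d (n - k) / qp d n) * (qp e k * qp e (n - k) / qp e n).
have termE j : (j <= n)%N -> term n j =
   S j * (q ^+ (j * (n - j))) ^+ 3 * (q ^- j - z * q ^+ j) / (1 - z).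
  move=> jn; have refl x x0 h := @qpoch_ratio_reflect n x j x0 zq h jn.
  have := refl z z0 nz; rewrite eq1 => reflz.
  rewrite /term -/e eqn -ee eqz reflz.
  rewrite (refl b b0 nb) (refl c c0 nc) (refl d d0 ndd) (refl e e0 ne).
  have Y : z ^+ j * q ^+ (j * j) = q ^- (j * (n - j)).
    apply: (mulIf (expf_neq0 (j * (n - j)) q0)).
    rewrite mulVf ?expf_neq0 // -mulrA -exprD -mulnDr subnKC //.
    by rewrite mulnC exprM -exprMn zq expr1n.
  have k6 : kappa j ^+ 6 = (z ^+ (2 * j) * q ^+ (j * j.+1)) ^+ 3.
    by rewrite -kappa_sqr -exprM.
  have -> : q ^+ (j * (n - j)) = (z ^+ j * q ^+ (j * j))^-1 by rewrite Y invrK.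
  (* The six signs cancel, and z z b c d e = z^3 w e = z^3 q. *)
  have prodx : (- z) ^+ j * (- z) ^+ j * (- b) ^+ j * (- c) ^+ j * (- d) ^+ j *
      (- e) ^+ j = (z ^+ j) ^+ 3 * q ^+ j.
    rewrite -!exprMn -exprM mulnC exprM -exprMn; congr (_ ^+ j).
    have we : w * e = q by rewrite /e eqz mulrC divfK.
    by rewrite -we /w; field; rewrite z0.
  have -> : (q ^- j - z * q ^+ j) = (1 - z * q ^+ (2 * j)) / q ^+ j.
    by rewrite mul2n -addnn exprD; field; rewrite expf_neq0.
  transitivity (S j * (1 - z * q ^+ (2 * j)) / (1 - z) *
    ((- z) ^+ j * (- z) ^+ j * (- b) ^+ j * (- c) ^+ j * (- d) ^+ j *
      (- e) ^+ j) / kappa j ^+ 6 * q ^+ j).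
    by rewrite /S -exprVn; ring.
  rewrite prodx k6 mulnS mul2n -addnn !exprD; field.
  by rewrite z1 !expf_neq0.
rewrite (termE _ kn) (termE (n - k)%N) ?leq_subr // /S subKn // (mulnC (n - k)%N).
(* Under k -> n-k the two terms of q^-k - z q^k are exchanged, which gives the sign; all other
   factors are symmetric. *)
have -> : q ^- (n - k) = z * q ^+ k.
  apply: (mulIf (expf_neq0 (n - k) q0)).
  by rewrite mulVf ?expf_neq0 // -mulrA -exprD subnKC.
have -> : q ^- k = z * q ^+ (n - k).
  apply: (mulIf (expf_neq0 k q0)).
  by rewrite mulVf ?expf_neq0 // -mulrA -exprD subnK.
by ring.
Qed.

Lemma term_sum_eq0 n : nondegenerate n -> z * q ^+ n = 1 ->
  \sum_(0 <= k < n.+1) term n k = 0.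
Proof.
move=> nd zq; set s := \sum_(_ <= _ < _) _.
have : s = - s.
  rewrite /s {1}big_nat_rev /= -sumrN big_nat [RHS]big_nat.
  by apply: eq_bigr => k /= kn; rewrite add0n subSS term_antisym.
by move/eqP; rewrite -subr_eq0 opprK -mulr2n mulrn_eq0 => /eqP.
Qed.

(** * Induction on n *)

Lemma P_neq0 n : nondegenerate n.+1 -> P (q ^+ n.+1) != 0.
Proof.
move=> [hb hc hd hw _].
have lt : (0 < n.+1 <= n.+1)%N by rewrite leqnn.
rewrite /P !mulf_neq0 ?subr_div_neq0 ?hb ?hc ?hd //.
by rewrite eq_sym hw.
Qed.

Lemma jackson_sum n : nondegenerate n ->
  \sum_(0 <= k < n.+1) term n k =
    qpochs [:: z * q; z * q / (b * c); z * q / (b * d); z * q / (c * d)] q n /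
    qpochs [:: z * q / b; z * q / c; z * q / d; z * q / (b * c * d)] q n.
Proof.
elim: n => [|n IH] nd.
  by rewrite big_nat1 term_0 /qpochs !big_cons !big_nil !qpoch0 !mulr1 divr1.
have [/eqP|h1] := boolP (1 - z * q ^+ n.+1 == 0).
  move/eqP; rewrite subr_eq0 => /eqP/esym zq; rewrite term_sum_eq0 //.
  rewrite /qpochs big_cons qpochS.
  by rewrite -[z * q * q ^+ n]mulrA -exprS zq subrr mulr0 !mul0r.
have nd' : nondegenerate n.
  have [hb hc hd hw hz] := nd; split=> i il.
  - by apply: hb; clear -il; lia.
  - by apply: hc; clear -il; lia.
  - by apply: hd; clear -il; lia.
  - by apply: hw; clear -il; lia.
  (* The range of i for n begins at n+1, which the range for n+1 omits; this value is covered by the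
     case assumption [h1]. *)
  have [->|ni] := eqVneq i n.+1; first by move: h1; rewrite subr_eq0 eq_sym.
  by apply: hz; clear -il ni; lia.
have e x : z * q / x * q ^+ n = z * q ^+ n.+1 / x by rewrite exprS; ring.
have e1 : z * q * q ^+ n = z * q ^+ n.+1 by rewrite exprS mulrA.
have e2 : z * q / (b * c * d) * q ^+ n = q ^+ n.+1 / w.
  by rewrite exprS /w; field; rewrite z0 d0 c0 b0.
have numS : qpochs [:: z * q; z * q / (b * c); z * q / (b * d); z * q / (c * d)]
    q n.+1 =
  qpochs [:: z * q; z * q / (b * c); z * q / (b * d); z * q / (c * d)] q n *
    N (q ^+ n.+1).
  by rewrite /qpochs !big_cons !big_nil !qpochS e1 !e /N; ring.
have denS : qpochs [:: z * q / b; z * q / c; z * q / d; z * q / (b * c * d)]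
    q n.+1 =
  qpochs [:: z * q / b; z * q / c; z * q / d; z * q / (b * c * d)] q n *
    P (q ^+ n.+1).
  by rewrite /qpochs !big_cons !big_nil !qpochS e2 !e /P; ring.
apply: (mulfI (P_neq0 nd)); rewrite term_sum_succ // (IH nd') numS denS.
have key (p x y m : K) : p != 0 -> m * (x / y) = p * (x * m / (y * p)).
  move=> p0; rewrite invfM; transitivity (m * (x / y) * (p / p)).
    by rewrite divff ?mulr1.
  by ring.
exact: key (P_neq0 nd).
Qed.

(** * Return to the parameter a *)

Lemma W87_termE n a k : a != 0 -> a * z * q ^+ n.+1 = b * c * d ->
  W87_term z [tuple b; c; d; z / a; q ^- n] q q k = term n k.
Proof.
move=> a0 hbal; have aw : a * q ^+ n.+1 = w by rewrite /w -hbal; field.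
have -> : z / a = z * q ^+ n.+1 / w by rewrite -aw; field; rewrite a0 expf_neq0.
have e : z * q / (z * q ^+ n.+1 / w) = w / q ^+ n.
  by rewrite exprS; field; rewrite z0 q0 w0 expf_neq0.
have e' : z * q / q ^- n = z * q ^+ n.+1 by rewrite invrK exprS mulrA.
by rewrite /W87_term /term /qp !big_cons big_nil e e' mulr1 !mulrA.
Qed.

Lemma W87_sum n a : a != 0 -> a * z * q ^+ n.+1 = b * c * d ->
  nondegenerate n ->
  \sum_(0 <= k < n.+1) W87_term z [tuple b; c; d; z / a; q ^- n] q q k =
    qpochs [:: z * q; z * q / (b * c); z * q / (b * d); z * q / (c * d)] q n /
    qpochs [:: z * q / b; z * q / c; z * q / d; z * q / (b * c * d)] q n.
Proof.
move=> a0 hbal nd; rewrite -jackson_sum //.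
by apply: eq_bigr => k _; rewrite W87_termE.
Qed.

End Jackson.

(** * Convergence of the terminating series, and the theorem over the complex numbers *)

Lemma cvg_series_finite_support (K : numFieldType) (u : nat -> K) n :
  (forall k, (n < k)%N -> u k = 0) ->
  cvgn (series u) /\ limn (series u) = \sum_(0 <= k < n.+1) u k.
Proof.
move=> u0; have e : \forall k \near \oo, series u k = \sum_(0 <= k < n.+1) u k.
  exists n.+1 => // k /= nk; rewrite /series /= (big_cat_nat (leq0n n.+1) nk) /=.
  rewrite [X in _ + X]big1_seq ?addr0 // => i.
  by rewrite mem_index_iota => /andP[_ /andP[ni _]]; apply: u0.
have h : series u @ \oo --> \sum_(0 <= k < n.+1) u k by apply: cvg_near_cst.
by split; [apply/cvg_ex; eexists; exact: h | apply: cvg_lim].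
Qed.

Lemma qpoch_quotient_neq (K : fieldType) (q z x : K) n i : x != 0 ->
  qpoch (z * q / x) q n != 0 -> (0 < i <= n)%N -> z * q ^+ i != x.
Proof.
move=> x0 /qpoch_neq0P h; case: i => // i /h; apply: contraNneq => e.
apply/eqP/(mulIf x0); rewrite mul1r -[RHS]e exprS; by field.
Qed.

Theorem proposition4p6 (R : realType) (q : R[i]) (n : nat) (a b c d z : R[i])
  (hq0 : 0 < `|q|) (hq1 : `|q| < 1)
  (ha : a != 0) (hb : b != 0) (hc : c != 0) (hd : d != 0) (hz : z != 0)
  (hbal : a * z * q ^+ n.+1 = b * c * d)
  (hz1 : 1 - z != 0)
  (hden : forall x, x \in [:: b; c; d; z / a; q ^- n] ->
     forall k, (k <= n)%N -> qpoch (z * q / x) q k != 0)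
  (hrhs : qpochs [:: z * q / b; z * q / c; z * q / d; z * q / (b * c * d)] q n
     != 0) :
  W87_convergent z [tuple b; c; d; z / a; q ^- n] q q /\
  W87 z [tuple b; c; d; z / a; q ^- n] q q =
    qpochs [:: z * q; z * q / (b * c); z * q / (b * d); z * q / (c * d)] q n /
    qpochs [:: z * q / b; z * q / c; z * q / d; z * q / (b * c * d)] q n.
Proof.
have q0 : q != 0 by rewrite -normr_gt0.
have hq i : (0 < i)%N -> q ^+ i != 1.
  move=> i0; have : `|q| ^+ i < 1 by rewrite exprn_ilt1 ?(ltW hq0) // -lt0n.
  by apply: contraTneq => e; rewrite -normrX e normr1 ltxx.
have hn x : x \in [:: b; c; d; z / a; q ^- n] -> x != 0 ->
    forall i, (0 < i <= n)%N -> z * q ^+ i != x.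
  by move=> xs x0 i; apply: qpoch_quotient_neq => //; apply: hden.
have nd : nondegenerate q b c d z n.
  split.
  - by apply: hn; rewrite ?inE ?eqxx ?orbT.
  - by apply: hn; rewrite ?inE ?eqxx ?orbT.
  - by apply: hn; rewrite ?inE ?eqxx ?orbT.
  (* As w = a q^(n+1), the equation w = q^i amounts to z q^(n+1-i) = z/a, excluded by the
     denominators of the parameter z/a. *)
  - move=> i lin; have := hn (z / a).
    rewrite !inE eqxx !orbT mulf_neq0 ?invr_neq0 // => /(_ isT isT (n.+1 - i)%N).
    have -> : (0 < n.+1 - i <= n)%N by clear -lin; lia.
    move=> /(_ isT); apply: contraNneq => e.
    apply/eqP/(mulIf ha); rewrite divfK //.
    have e' : a * q ^+ n.+1 = q ^+ i by rewrite -e -hbal; field.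
    apply: (mulIf (expf_neq0 i q0)); rewrite -[in RHS]e'.
    have -> : n.+1 = (n.+1 - i + i)%N by clear -lin; lia.
    by rewrite addnK exprD; ring.
  (* Likewise z q^i = 1 amounts to z q^(i-n) = q^-n. *)
  - move=> i lin; have := hn (q ^- n).
    rewrite !inE eqxx !orbT invr_neq0 ?expf_neq0 // => /(_ isT isT (i - n)%N).
    have -> : (0 < i - n <= n)%N by clear -lin; lia.
    move=> /(_ isT); apply: contraNneq => e.
    apply/eqP/(mulIf (expf_neq0 n q0)).
    rewrite mulVf ?expf_neq0 // -mulrA -exprD subnK ?e //; clear -lin; lia.
(* Beyond k = n other denominators may vanish; the factor (q^-n; q)_k = 0 still makes the term 0,
   because the inverse of 0 is 0. *)
have tail k : (n < k)%N -> W87_term z [tuple b; c; d; z / a; q ^- n] q q k = 0.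
  by move=> nk; rewrite /W87_term !big_cons (qpoch_expN_eq0 q0 nk) !(mul0r, mulr0).
have [cv lim] := cvg_series_finite_support tail.
by split=> //; rewrite /W87 lim W87_sum.
Qed.
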